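(* There is a distributed language $\mathcal{L}$ such that $\mathcal{L}\notin B_\infty(t)$ for every function $t=o(n)$. That is, for every $t=o(n)$ and all constants $p,q\in(0,1]$ with $p+q>1$, $\mathcal{L}$ has no randomized $(p,q)$-decider running in at most $t$ rounds.
   Context: Model ($\mathcal{LOCAL}$). The network is a connected graph $G$ on $n$ nodes. An identity assignment $\mathrm{Id}$ gives distinct integers to the nodes. All nodes start simultaneously, run the same algorithm, and proceed in fault-free synchronous rounds; in each round every node sends messages of unlimited size to its neighbors, receives the messages of its neighbors, and performs arbitrary local computations. Initially a node knows only its identity and its local input (in particular not $n$). Each node eventually terminates and outputs ''yes'' or ''no''; the number of rounds may vary among nodes. In $t$ rounds, the output of a node depends only on the radius-$t$ neighborhood around it (structure, identities, inputs, and random bits). In a randomized algorithm, each node may in addition generate private, mutually independent random bits at any round. Languages. Let $\Sigma$ be a finite or infinite set of symbols (possibly a single symbol, the empty input). An instance is a pair $(G,\mathbf{x})$ where $G$ is a connected $n$-node graph and $\mathbf{x}\in\Sigma^n$ assigns to each node $v$ a local input $\mathbf{x}(v)\in\Sigma$; instances are regarded as input-labelled graphs, up to isomorphism. A distributed language $\mathcal{L}$ is a decidable collection of instances. Deciders. For constants $p,q\in(0,1]$, a randomized algorithm is a $(p,q)$-decider for $\mathcal{L}$ if for every instance $(G,\mathbf{x})$ and every identity assignment $\mathrm{Id}$, every node eventually terminates with output ''yes'' or ''no'', and: if $(G,\mathbf{x})\in\mathcal{L}$ then $\Pr[\text{all nodes output ''yes''}]\ge p$; if $(G,\mathbf{x})\notin\mathcal{L}$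 then $\Pr[\text{at least one node outputs ''no''}]\ge q$. Its running time on $(G,\mathbf{x},\mathrm{Id})$ is the maximum, over all nodes and all coin tosses, of the number of rounds until termination. For a function $t$ of triplets $(G,\mathbf{x},\mathrm{Id})$, $\mathrm{BPLD}(t,p,q)$ is the class of languages having a $(p,q)$-decider with running time at most $t(G,\mathbf{x},\mathrm{Id})$ on every $(G,\mathbf{x},\mathrm{Id})$. Here $t=o(n)$ means that $t(G,\mathbf{x},\mathrm{Id})/n\to0$ uniformly over triplets on $n$-node graphs as $n\to\infty$. $B_\infty(t)=\bigcup_{p,q\in(0,1],\ p+q>1}\mathrm{BPLD}(t,p,q)$. *)

(* Defs.v *)
From HB Require Import structures.
From mathcomp Require Import all_boot all_order all_algebra.
From mathcomp Require Import all_classical all_reals all_analysis.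

Set Implicit Arguments.
Unset Strict Implicit.
Unset Printing Implicit Defensive.

Import Order.TTheory GRing.Theory Num.Theory.

Local Open Scope ring_scope.
Local Open Scope classical_set_scope.

Record network := Network {
  order : nat;
  adj : rel 'I_order;
  order_gt0 : (0 < order)%N;
  adj_sym : symmetric adj;
  adj_irr : irreflexive adj;
  adj_connected : forall u v, connect adj u v }.

Record instance (Sigma : Type) := Instance {
  graph :> network;
  input : 'I_(order graph) -> Sigma }.

Definition isomorphic (Sigma : Type) (I J : instance Sigma) : Prop :=
  exists f : 'I_(order I) -> 'I_(order J),
    [/\ bijective f,
        forall u v, adj (f u) (f v) = adj u v
      & forall v, input (f v) = input v].

Record triplet (Sigma : Type) := Triplet {
  inst :> instance Sigma;
  ident : 'I_(order inst) -> int;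
  ident_inj : injective ident }.

(* A deterministic machine with one two-way infinite tape. A tape symbol is
   [None] (the blank), an input letter or an auxiliary letter; a state is
   halting, accepting (resp. rejecting), when its [answer] is [Some true]
   (resp. [Some false]). *)
Inductive direction := ToLeft | ToRight.

Record machine (A : finType) := Machine {
  control : finType;
  work : finType;
  start : control;
  answer : control -> option bool;
  trans : control -> option (A + work) ->
          control * option (A + work) * direction }.

Record machine_config (A : finType) (M : machine A) := MachineConfig {
  mc_control : control M;
  mc_tape : int -> option (A + work M);
  mc_head : int }.

Definition machine_init (A : finType) (M : machine A) (w : seq A) :
    machine_config M :=
  MachineConfig (start M)
    (fun i => if i is Posz k then omap inl (onth w k) else None) 0.

Definition machine_step (A : finType) (M : machine A) (c : machine_config M) :
    machine_config M :=
  if answer (mc_control c) is Some _ then c else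
  let: (s, a, d) := trans (mc_control c) (mc_tape c (mc_head c)) in
  MachineConfig s
    (fun i => if i == mc_head c then a else mc_tape c i)
    (if d is ToRight then mc_head c + 1 else mc_head c - 1).

Definition machine_answers (A : finType) (M : machine A) (w : seq A)
    (b : bool) : Prop :=
  exists k, answer (mc_control (iter k (@machine_step A M) (machine_init M w)))
            = Some b.

(* An instance is written over the alphabet {1, 0, #}, with # encoded as
   [None]: for each node, its row of the adjacency matrix, #, the number of its
   input symbol in unary, #. A countable set of symbols is effectively
   presented by the numbering [pickle]. *)
Definition encode (Sigma : countType) (I : instance Sigma) :
    seq (option bool) :=
  flatten [seq [seq Some (adj u v) | v <- enum 'I_(order I)] ++ None ::
               rcons (nseq (pickle (input u)) (Some true)) None
          | u <- enum 'I_(order I)].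

Definition decidable_language (Sigma : countType) (L : instance Sigma -> Prop) :
    Prop :=
  exists M : machine (option bool), forall I : instance Sigma,
    (L I -> machine_answers M (encode I) true) /\
    (~ L I -> machine_answers M (encode I) false).

Record language (Sigma : countType) := Language {
  member :> instance Sigma -> Prop;
  member_iso : forall I J, isomorphic I J -> member I -> member J;
  member_decidable : decidable_language member }.

(* A node starts in the state [init id x]. At the start, and again after each
   communication round, it draws [nbits s] fresh private bits, where [s] is its
   current state, and performs the local computation [compute]. The number of
   bits may depend on the state in any way, so there is no loss in asking for
   them all at once: a computation that draws bits one by one and halts on every
   outcome uses boundedly many of them.
   In each round a node in state [s] sends [send s i] to its neighbour of
   identity [i] (a rule that ignores [i] is a plain broadcast), and [receive]s
   an inbox, which maps [i] to the message sent by the neighbour of identity [i],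
   and to [None] if there is no such neighbour. *)
Record algorithm (Sigma : Type) := Algorithm {
  state : Type;
  message : Type;
  init : int -> Sigma -> state;
  nbits : state -> nat;
  compute : state -> seq bool -> state;
  send : state -> int -> message;
  receive : state -> (int -> option message) -> state;
  output : state -> option bool }.

Section Execution.
Variables (Sigma : Type) (A : algorithm Sigma) (T : triplet Sigma).

(* [w (v, r, k)] is the [k]-th bit drawn by node [v] after round [r]. *)
Definition coin_index : Type := 'I_(order T) * nat * nat.

Implicit Types (w : coin_index -> bool) (r : nat) (v : 'I_(order T)).

Definition local_step w r v (s : state A) : state A :=
  compute s (mkseq (fun k => w (v, r, k)) (nbits s)).

Definition inbox (c : 'I_(order T) -> state A) v (i : int) :
    option (message A) :=
  if [pick u | adj u v && (ident u == i)] is Some u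
  then Some (send (c u) (ident v)) else None.

Fixpoint execution w r : 'I_(order T) -> state A :=
  if r is r'.+1 then
    fun v => local_step w r v
               (receive (execution w r' v) (inbox (execution w r') v))
  else fun v => local_step w 0 v (init A (ident v) (input v)).

(* Node [v] terminates after exactly [r] rounds with output [b] ([true] stands
   for "yes"). The output is irrevocable; a node that has produced its output
   may still relay messages, so that a node running [r] rounds can depend on
   its whole radius-[r] neighbourhood. *)
Definition outputs_at w r v (b : bool) : Prop :=
  output (execution w r v) = Some b /\
  forall r', (r' < r)%N -> output (execution w r' v) = None.

Definition outputs w v (b : bool) : Prop := exists r, outputs_at w r v b.

Definition all_yes w : Prop := forall v, outputs w v true.
Definition some_no w : Prop := exists v, outputs w v false.

Definition terminates : Prop := forall w v, exists b, outputs w v b.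

Definition runs_within (R : realType) (bound : R) : Prop :=
  forall w v r b, outputs_at w r v b -> r%:R <= bound.

End Execution.

Definition fair_coins (R : realType) (d : measure_display)
    (Omega : measurableType d) (P : probability Omega R) (J : choiceType)
    (coin : J -> {RV P >-> bool}) : Prop :=
  (forall j b, P (coin j @^-1` [set b]) = (2^-1)%:E) /\
  (forall (s : seq J) (b : J -> bool), uniq s ->
     P [set w | forall j, j \in s -> coin j w = b j] =
     (\prod_(j <- s) P (coin j @^-1` [set b j]))%E).

(* The probabilities do not depend on the probability space that carries the
   bits, hence the quantification over all of them. *)
Definition decider (Sigma : countType) (R : realType) (p q : R)
    (L : language Sigma) (A : algorithm Sigma) : Prop :=
  forall T : triplet Sigma,
    terminates A T /\
    forall (d : measure_display) (Omega : measurableType d)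
           (P : probability Omega R) (coin : coin_index T -> {RV P >-> bool}),
      fair_coins coin ->
      (L T -> (p%:E <= P [set w | all_yes A (fun j => coin j w)])%E) /\
      (~ L T -> (q%:E <= P [set w | some_no A (fun j => coin j w)])%E).

Definition BPLD (Sigma : countType) (R : realType) (t : triplet Sigma -> R)
    (p q : R) : set (language Sigma) :=
  [set L | exists A : algorithm Sigma,
             decider p q L A /\ forall T, runs_within A T (t T)].

Definition B_infty (Sigma : countType) (R : realType)
    (t : triplet Sigma -> R) : set (language Sigma) :=
  [set L | exists p q : R,
             [/\ 0 < p <= 1, 0 < q <= 1, 1 < p + q & BPLD t p q L]].

Definition sublinear (Sigma : Type) (R : realType) (t : triplet Sigma -> R) :
    Prop :=
  forall eps : R, 0 < eps -> exists N : nat, forall T : triplet Sigma,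
    (N <= order T)%N -> `|t T / (order T)%:R| <= eps.

(* Main.v *)
(* The language asks that at least one node be selected (have input [true]).
   On a long path, let no node be selected: an algorithm running in K rounds
   must then say "no" somewhere with probability at least q. Take N + 1 nodes at
   mutual distance more than 4K, each the centre of an arc of radius K. Selecting
   the first centre gives an instance of the language, and leaves the behaviour
   of the other N arcs unchanged, so all of them say "yes" with probability at
   least p; as they are independent, one of them says "yes" with probability
   greater than a = 1 - (p + q - 1) / 2 once a^N < p. Selecting the centre of
   that arc leaves everything outside the arc unchanged, so with no node selected
   everybody says "yes" with probability at least p - (1 - a) > 1 - q. *)
Require Import Defs.
From mathcomp Require Import all_boot all_order all_algebra.
From mathcomp Require Import all_classical all_reals all_analysis.
From mathcomp Require Import lra zify.
Import Defs.

Set Implicit Arguments.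
Unset Strict Implicit.
Unset Printing Implicit Defensive.

Import Order.TTheory GRing.Theory Num.Theory numFieldNormedType.Exports.

Local Open Scope classical_set_scope.
Local Open Scope ring_scope.

(** * The language *)

Definition some_selected (I : instance bool) : Prop := exists v, input (i := I) v.

Lemma some_selected_iso I J : isomorphic I J -> some_selected I -> some_selected J.
Proof. by case=> f [_ _ fin] [v xv]; exists (f v); rewrite fin. Qed.

(* In state [inl b] the machine scans to the right, [b] telling whether the head
   is on the input part of a row; in state [inr b] it has answered [b]. *)
Definition scanner_trans (c : bool + bool) (a : option (option bool + void)) :
    (bool + bool) * option (option bool + void) * direction :=
  match c, a with
  | inl _, None => (inr false, a, ToRight)
  | inl b, Some (inl None) => (inl (~~ b), a, ToRight)
  | inl true, Some _ => (inr true, a, ToRight)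
  | _, _ => (c, a, ToRight)
  end.

Definition scanner : machine (option bool) :=
  @Machine (option bool) (bool + bool)%type void (inl false)
    (fun c => if c is inr b then Some b else None) scanner_trans.

Fixpoint scan (b : bool) (s : seq (option bool)) : bool :=
  match s with
  | [::] => false
  | None :: s' => scan (~~ b) s'
  | Some _ :: s' => b || scan b s'
  end.

Lemma scanner_answers s : machine_answers scanner s (scan false s).
Proof.
pose tape t i : option (option bool + void) :=
  if i is Posz k then omap inl (onth t k) else None.
suff H pre t b : exists k, answer (mc_control (iter k (@machine_step _ scanner)
    (@MachineConfig _ scanner (inl b) (tape (pre ++ t)) (size pre)))) =
    Some (scan b t).
  exact: (H [::] s false).
(* Every transition writes back the symbol it reads, so the tape never changes and only the state
   and the head move. *)
have step_right (c c' : control scanner) (w : seq (option bool)) (h : nat) :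
    answer c = None -> trans c (tape w h) = (c', tape w h, ToRight) ->
    machine_step (@MachineConfig _ scanner c (tape w) h) =
    @MachineConfig _ scanner c' (tape w) h.+1.
  move=> cN ct; rewrite /machine_step; cbn [mc_control mc_tape mc_head].
  rewrite cN ct; congr MachineConfig.
    by apply/funext => i; case: eqP => [->|].
  by rewrite -addn1 PoszD.
elim: t pre b => [|a t IH] pre b.
  have ta : tape pre (size pre) = None by rewrite /= onth_default.
  by exists 1%N; rewrite /= cats0 (step_right _ (inr false)) // ta; case: (b).
have ta : tape (pre ++ a :: t) (size pre) = Some (inl a).
  by rewrite /= onth_cat ltnn subnn.
case: a ta => [a|] ta.
  case: b.
    by exists 1%N; rewrite /= (step_right _ (inr true)) // ta.
  have [k hk] := IH (rcons pre (Some a)) false; exists k.+1.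
  rewrite iterSr (step_right _ (inl false)) ?ta //.
  by rewrite -cats1 -catA size_cat addn1 /= in hk.
have [k hk] := IH (rcons pre None) (~~ b); exists k.+1.
rewrite iterSr (step_right _ (inl (~~ b))) ?ta //=; last by case: (b).
by rewrite -cats1 -catA size_cat addn1 /= in hk.
Qed.

(** [pickle] sends [false] to 0 and [true] to a positive number, so the unary block of a node is
    nonempty exactly when the node is selected. The two separators of a row bring the flag back to
    [false]. *)
Lemma scan_encode (I : instance bool) :
  scan false (encode I) = has (@input _ I) (enum 'I_(order I)).
Proof.
(* Rows and columns both range over the nodes; the induction shortens the list of rows only. *)
suff H us vs : scan false (flatten [seq [seq Some (adj u v) | v <- vs] ++
    None :: rcons (nseq (pickle (input u)) (Some true)) None | u <- us]) =
    has (@input _ I) us by exact: H.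
elim: us vs => // u us IH vs /=.
rewrite -!catA /= -(IH vs).
have -> s : scan false ([seq Some (adj u v) | v <- vs] ++ s) = scan false s.
  by elim: (vs).
by rewrite /=; case: (input u).
Qed.

Lemma some_selected_decidable : decidable_language some_selected.
Proof.
exists scanner => I; have := scanner_answers (encode I).
rewrite scan_encode; case: hasP => [[v _ xv]|no] ans; split=> //.
  by case; exists v.
by case=> v xv; case: no; exists v; rewrite ?mem_enum.
Qed.

Definition selection_language : language bool :=
  Language some_selected_iso some_selected_decidable.

(** * Locality on a path *)

Definition path_adj n : rel 'I_n := fun u v => (u.+1 == v) || (v.+1 == u).

Lemma path_adj_sym n : symmetric (@path_adj n).
Proof. by move=> u v; rewrite /path_adj orbC. Qed.

Lemma path_adj_irr n : irreflexive (@path_adj n).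
Proof. by move=> u; rewrite /path_adj orbb; apply/eqP; lia. Qed.

Lemma path_connected n (u v : 'I_n) : connect (@path_adj n) u v.
Proof.
wlog le_uv : u v / (u <= v)%N.
  move=> H; case: (leqP u v) => [/H//|/ltnW/H].
  by rewrite (sym_connect_sym (@path_adj_sym n)).
case: v le_uv => v; elim: v => [|v IH] lt_v le_uv.
  by rewrite (_ : u = Ordinal lt_v) //; apply/val_inj/eqP; rewrite -leqn0.
move: le_uv; rewrite leq_eqVlt => /predU1P[e|lt_u].
  by rewrite (_ : u = Ordinal lt_v) //; apply: val_inj.
apply: connect_trans (IH (ltnW lt_v) lt_u) _.
by apply: connect1; rewrite /path_adj /= eqxx.
Qed.

Definition path_network m : network :=
  Network (ltn0Sn m) (@path_adj_sym m.+1) (@path_adj_irr m.+1)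
    (@path_connected m.+1).

Lemma path_ident_inj m : injective (fun v : 'I_m.+1 => Posz v).
Proof. by move=> u v [] /val_inj. Qed.

Definition path_triplet m (x : 'I_m.+1 -> bool) : triplet bool :=
  @Triplet bool (@Instance bool (path_network m) x) _ (@path_ident_inj m).

Definition within_dist n r (u v : 'I_n) : bool :=
  ((u <= v + r) && (v <= u + r))%N.

(** A round reads the states of [v] and its neighbours, whose balls of radius [r] lie in the ball of
    radius [r.+1] around [v]. Both triplets use positions as identities, so only inputs and coins
    can differ. *)
Lemma execution_local (A : algorithm bool) m (x y : 'I_m.+1 -> bool)
    (w w' : 'I_m.+1 * nat * nat -> bool) r (v : 'I_m.+1) :
  (forall u, within_dist r u v -> x u = y u) ->
  (forall u r' k, within_dist r u v -> w (u, r', k) = w' (u, r', k)) ->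
  @execution _ A (path_triplet x) w r v = @execution _ A (path_triplet y) w' r v.
Proof.
elim: r v => [|r IH] v xy ww'.
  rewrite /= /local_step /= xy; last by rewrite /within_dist !addn0 leqnn.
  congr compute; apply: eq_mkseq => k; apply: ww'.
  by rewrite /within_dist !addn0 leqnn.
have sub u : adj (n := path_network m) u v || (u == v) ->
    @execution _ A (path_triplet x) w r u = @execution _ A (path_triplet y) w' r u.
  move=> uv; apply: IH => [t|t r' k] tu; [apply: xy|apply: ww'];
    move: uv tu; rewrite /within_dist /= /path_adj -val_eqE /=; lia.
rewrite /= /local_step (sub v) ?eqxx ?orbT //.
have -> : inbox (@execution _ A (path_triplet x) w r) v =
          inbox (@execution _ A (path_triplet y) w' r) v.
  apply/funext => i; rewrite /inbox /=; case: pickP => // u /andP[uv _].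
  by rewrite sub //= uv.
by congr compute; apply: eq_mkseq => k; apply: ww'; rewrite /within_dist; lia.
Qed.

(** * Events determined by finitely many fair coins *)

(** The codomain is arbitrary so that the notion covers states, numbers of bits and, with [X] equal
    to [Prop], events. *)
Definition determined_by (J : eqType) (X : Type) (s : seq J)
    (f : (J -> bool) -> X) : Prop :=
  forall w w', {in s, w =1 w'} -> f w = f w'.

Definition set_coin (J : eqType) (j : J) (b : bool) (w : J -> bool) : J -> bool :=
  fun i => if i == j then b else w i.

Lemma set_coin_id (J : eqType) (j : J) w : set_coin j (w j) w = w.
Proof. by apply/funext => i; rewrite /set_coin; case: eqP => [->|]. Qed.

Lemma determined_sub (J : eqType) X (s s' : seq J) (f : (J -> bool) -> X) :
  {subset s <= s'} -> determined_by s f -> determined_by s' f.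
Proof. by move=> ss' fs w w' ww'; apply: fs => j /ss'; exact: ww'. Qed.

Lemma determined_set_coin (J : eqType) X j b (s : seq J) (f : (J -> bool) -> X) :
  determined_by (j :: s) f -> determined_by s (f \o set_coin j b).
Proof.
move=> fs w w' ww'; apply: fs => i; rewrite inE /set_coin.
by case: eqP => //= _; exact: ww'.
Qed.

(** One passes from [w] to [w'] through the hybrid equal to [w] on [Q] and to [w'] elsewhere, using
    one of the two supports at each step. This confines a finitely determined event to the coins of
    a region. *)
Lemma determined_filter (J : eqType) X (Q : pred J) (s : seq J)
    (f : (J -> bool) -> X) :
  determined_by s f -> (forall w w', {in Q, w =1 w'} -> f w = f w') ->
  determined_by [seq j <- s | Q j] f.
Proof.
move=> fs fQ w w' ww'; rewrite (fQ w (fun j => if Q j then w j else w' j)).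
  by apply: fs => j sj; case: ifP => // Qj; apply: ww'; rewrite mem_filter Qj.
by move=> j; rewrite unfold_in => ->.
Qed.

Lemma determined_bounded (J : eqType) (s : seq J) (f : (J -> bool) -> nat) :
  determined_by s f -> exists M, forall w, (f w <= M)%N.
Proof.
elim: s f => [|j s IH] f fs.
  by exists (f (fun=> false)) => w; rewrite (fs w (fun=> false)).
have [M0 h0] := IH _ (determined_set_coin false fs).
have [M1 h1] := IH _ (determined_set_coin true fs).
exists (maxn M0 M1) => w; rewrite leq_max -(set_coin_id j w).
by case: (w j); rewrite (h0, h1) ?orbT.
Qed.

Lemma determined_family (J : eqType) (X : Type) (I : finType)
    (f : I -> (J -> bool) -> X) :
  (forall i, exists s, determined_by s (f i)) ->
  exists s, forall i, determined_by s (f i).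
Proof.
move=> /choice[s fs]; exists (flatten [seq s i | i <- enum I]) => i.
apply: determined_sub (fs i) => j sj; apply/flatten_mapP.
by exists i; rewrite ?mem_enum.
Qed.

(* The number of bits that a node draws is bounded over all outcomes because the
   state that fixes it is itself determined by finitely many coins. *)
Lemma execution_determined Sigma (A : algorithm Sigma) (T : triplet Sigma) r :
  exists s : seq (coin_index T),
    forall v, determined_by s (fun w => execution A w r v).
Proof.
have step r' s (st : (coin_index T -> bool) -> 'I_(order T) -> state A) :
    (forall v, determined_by s (st^~ v)) ->
    exists s', forall v, determined_by s' (fun w => local_step w r' v (st w v)).
  move=> sts; apply: determined_family => v.
  have /determined_bounded[M hM] : determined_by s (fun w => nbits (st w v)).
    by move=> w w' ww'; rewrite (sts v _ _ ww').
  exists (s ++ [seq (v, r', k) | k <- iota 0 M]) => w w' ww'.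
  rewrite /local_step -(sts v w w'); last first.
    by move=> j sj; apply: ww'; rewrite mem_cat sj.
  congr compute; apply/eq_in_map => k; rewrite mem_iota /= => lt_k.
  apply: ww'; rewrite mem_cat; apply/orP; right; apply: map_f.
  by rewrite mem_iota /=; apply: leq_trans lt_k (hM w).
elim: r => [|r [s IH]]; first by apply: (step 0%N [::]) => v w w' _.
apply: (step _ s) => v w w' ww'.
by congr receive; [exact: IH|congr inbox; apply/funext => u; exact: IH].
Qed.

(** * Probabilities of finitely determined events *)

Definition coin_event (R : realType) d (Omega : measurableType d)
    (P : probability Omega R) (J : Type) (coin : J -> {RV P >-> bool})
    (D : set (J -> bool)) : set Omega :=
  [set o | D (fun j => coin j o)].

(** A real number rather than an extended one, to allow field arithmetic; [lawE] shows that nothing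
    is lost on finitely determined events. *)
Definition law (R : realType) d (Omega : measurableType d)
    (P : probability Omega R) (J : Type) (coin : J -> {RV P >-> bool})
    (D : set (J -> bool)) : R :=
  fine (P (coin_event coin D)).

Definition cylinder (J : eqType) (s : seq J) (b : J -> bool) : set (J -> bool) :=
  [set w : J -> bool | {in s, w =1 b}].

Lemma determined_cylinder (J : eqType) (s : seq J) b :
  determined_by s (cylinder s b).
Proof.
move=> w w' ww'; apply/propext; split=> wb j sj; first by rewrite -ww' ?wb.
by rewrite ww' ?wb.
Qed.

Lemma cylinder_cons (J : eqType) (j : J) (s : seq J) b c : j \notin s ->
  cylinder s b `&` cylinder [:: j] (fun=> c) = cylinder (j :: s) (set_coin j c b).
Proof.
move=> js; apply/seteqP; split=> w.
  move=> [ws wj] i; rewrite inE /set_coin; case: eqP => [->|_ /ws//] _.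
  by apply: wj; rewrite inE.
move=> ws; split=> i si.
  rewrite ws ?inE ?si ?orbT // /set_coin; case: eqP => // ij.
  by rewrite ij (negbTE js) in si.
by move: si; rewrite inE => /eqP ->; rewrite ws ?inE ?eqxx // /set_coin eqxx.
Qed.

Lemma determinedI (J : eqType) (s s' : seq J) (D D' : set (J -> bool)) :
  determined_by s D -> determined_by s' D' ->
  determined_by (s ++ s') (D `&` D').
Proof.
move=> Ds Ds' w w' ww'; rewrite /setI /mkset (Ds w w') ?(Ds' w w') // => j sj;
  by apply: ww'; rewrite mem_cat sj ?orbT.
Qed.

Lemma determined_nil (J : eqType) (D : set (J -> bool)) :
  determined_by [::] D -> D = setT \/ D = set0.
Proof.
move=> D0; have [Df|nDf] := pselect (D (fun=> false)); [left|right].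
  by apply/seteqP; split=> // w _; rewrite (D0 w (fun=> false)).
by apply/seteqP; split=> // w; rewrite (D0 w (fun=> false)).
Qed.

(** Conditioning on one coin: once [j] is known to show [b], [D] can be replaced by an event that
    ignores [j], which shortens the support in the inductions below. *)
Lemma determined_split (J : eqType) (j : J) b (D : set (J -> bool)) :
  D `&` cylinder [:: j] (fun=> b) =
  cylinder [:: j] (fun=> b) `&` (D \o set_coin j b).
Proof.
suff H w : cylinder [:: j] (fun=> b) w -> set_coin j b w = w.
  apply/seteqP; split=> w [].
    by move=> Dw wb; split=> //; rewrite /= H.
  by move=> wb; rewrite /= H.
by move=> /(_ j); rewrite inE eqxx => /(_ isT) <-; rewrite set_coin_id.
Qed.

Lemma measurable_coin_event (R : realType) d (Omega : measurableType d)
    (P : probability Omega R) (J : eqType) (coin : J -> {RV P >-> bool})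
    (s : seq J) (D : set (J -> bool)) :
  determined_by s D -> measurable (coin_event coin D).
Proof.
elim: s D => [|j s IH] D Ds.
  case: (determined_nil Ds) => ->; [rewrite (_ : coin_event _ _ = setT)|
    rewrite (_ : coin_event _ _ = set0)] => //.
pose half b := coin j @^-1` [set b] `&` coin_event coin (D \o set_coin j b).
have -> : coin_event coin D = half true `|` half false.
  apply/seteqP; split=> o; rewrite /half /coin_event /=.
    rewrite -{1}(set_coin_id j (fun i => coin i o)).
    by case: (coin j o); [left|right].
  by rewrite -{3}(set_coin_id j (fun i => coin i o)); case=> -[->].
apply: measurableU; apply: measurableI; last 1 first.
- exact/IH/determined_set_coin.
- exact: measurable_funPTI.
- exact/IH/determined_set_coin.
- exact: measurable_funPTI.
Qed.

Section Law.
Variables (R : realType) (d : measure_display) (Omega : measurableType d).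
Variables (P : probability Omega R) (J : choiceType).
Variable coin : J -> {RV P >-> bool}.
Implicit Types (s : seq J) (D : set (J -> bool)).

Local Notation law := (law coin).

Lemma lawE s D : determined_by s D -> P (coin_event coin D) = (law D)%:E.
Proof.
move=> Ds; rewrite fineK // fin_num_measure //.
exact: measurable_coin_event Ds.
Qed.

Lemma law_ge0 D : 0 <= law D.
Proof. by rewrite fine_ge0. Qed.

Lemma law_le s s' D D' :
  determined_by s D -> determined_by s' D' -> D `<=` D' -> law D <= law D'.
Proof.
move=> Ds Ds' DD'; rewrite -lee_fin -(lawE Ds) -(lawE Ds').
apply: le_measure; rewrite ?inE; try exact: measurable_coin_event Ds.
  exact: measurable_coin_event Ds'.
by move=> o; exact: DD'.
Qed.

Lemma law_setU s s' D D' :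
  determined_by s D -> determined_by s' D' -> D `&` D' = set0 ->
  law (D `|` D') = law D + law D'.
Proof.
move=> Ds Ds' DD'; rewrite /law (_ : coin_event coin (D `|` D') =
  coin_event coin D `|` coin_event coin D') //.
rewrite measureU.
- by apply: fineD; apply: fin_num_measure; apply: measurable_coin_event;
    [exact: Ds|exact: Ds'].
- exact: measurable_coin_event Ds.
- exact: measurable_coin_event Ds'.
- have DD0 : D `&` D' `<=` set0 by rewrite DD'.
  by apply/seteqP; split=> // o; exact: (DD0 (fun j => coin j o)).
Qed.

Lemma law_split s D j : determined_by s D ->
  law D = law (D `&` cylinder [:: j] xpredT) + law (D `&` cylinder [:: j] xpred0).
Proof.
move=> Ds; rewrite -(law_setU (determinedI Ds (determined_cylinder _))
  (determinedI Ds (determined_cylinder _))).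
  congr (law _); apply/seteqP; split=> w; last by case=> -[].
  move=> Dw; case wj: (w j); [left|right]; split=> // i;
  by rewrite inE => /eqP ->.
apply/seteqP; split=> // w [[_ /(_ j)] wj [_ /(_ j)]].
by move: wj; rewrite inE eqxx => /(_ isT) -> /(_ isT).
Qed.

Lemma law_setT : law setT = 1.
Proof. by rewrite /law (_ : coin_event coin setT = setT) // probability_setT. Qed.

Lemma law_set0 : law set0 = 0.
Proof. by rewrite /law (_ : coin_event coin set0 = set0) // measure0. Qed.

Hypothesis fair : fair_coins coin.

Lemma law_cylinder s b : uniq s -> law (cylinder s b) = 2^-1 ^+ size s.
Proof.
move=> us; rewrite /law -[coin_event _ _]/[set o | forall j, j \in s -> coin j o = b j].
rewrite (fair.2 s b us).
rewrite (eq_bigr (fun=> (2^-1)%:E)); last by move=> j _; exact: fair.1.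
by rewrite prodEFin big_const_seq count_predT iter_mulr_1.
Qed.

(** Induction on the support of [D]: revealing its first coin [j] moves [j] into the cylinder, whose
    law is halved, and the two values of [j] are then summed. *)
Lemma law_cylinderI s s' b D : uniq s -> uniq s' -> ~~ has (mem s) s' ->
  determined_by s' D ->
  law (cylinder s b `&` D) = law (cylinder s b) * law D.
Proof.
move=> + + + Ds'; elim: s' s b D Ds' => [|j s' IH] s b D Ds' us.
  case: (determined_nil Ds') => -> _ _; first by rewrite setIT law_setT mulr1.
  by rewrite setI0 law_set0 mulr0.
move=> /= /andP[js' us'] /norP[/= js ss'].
have half c : law (D `&` cylinder [:: j] (fun=> c)) =
    2^-1 * law (D \o set_coin j c).
  rewrite determined_split IH ?law_cylinder //; first exact: determined_set_coin.
  by apply/hasPn => i s'i /=; rewrite inE; apply: contraNneq js' => <-.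
have halfs c : law (cylinder s b `&` D `&` cylinder [:: j] (fun=> c)) =
    2^-1 * law (cylinder s b) * law (D \o set_coin j c).
  rewrite -setIA determined_split setIA.
  rewrite cylinder_cons // (IH _ _ _ (determined_set_coin c Ds')) ?law_cylinder //=;
    rewrite ?exprS ?js //.
  apply/hasPn => i s'i; rewrite /= inE negb_or (hasPn ss' _ s'i) andbT.
  by apply: contraNneq js' => <-.
rewrite (law_split j (determinedI (determined_cylinder b) Ds')).
by rewrite (law_split j Ds') !half !halfs; lra.
Qed.

Lemma law_indep s s' D D' : determined_by s D -> determined_by s' D' ->
  ~~ has (mem s) s' -> law (D `&` D') = law D * law D'.
Proof.
move=> + + ss'.
(* The product formula for fair coins holds for duplicate-free lists only. *)
have {ss'} : ~~ has (mem (undup s)) (undup s').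
  by apply/hasPn => i; rewrite /= !mem_undup => /(hasPn ss').
have Hu (t : seq J) E : determined_by t E -> determined_by (undup t) E.
  by apply: determined_sub => i; rewrite mem_undup.
move=> + /Hu + /Hu; move: (undup_uniq s) (undup_uniq s') => {Hu}.
move: (undup s) (undup s') => {}s {}s' us us' ss'.
elim: s us ss' D => [|j s IH] us ss' D Ds Ds'.
  case: (determined_nil Ds) => ->; first by rewrite setTI law_setT mul1r.
  by rewrite set0I law_set0 mul0r.
move: us ss' => /= /andP[js us] ss'.
have {}ss' i : i \in s' -> (i != j) && (i \notin s).
  by move=> /(hasPn ss') /=; rewrite inE negb_or.
have half c : law (D `&` cylinder [:: j] (fun=> c)) =
    2^-1 * law (D \o set_coin j c).
  rewrite determined_split (@law_cylinderI _ s) ?law_cylinder //.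
    by apply/hasPn => i si; rewrite /= inE; apply: contraNneq js => <-.
  exact: determined_set_coin.
have halfs c : law (D `&` D' `&` cylinder [:: j] (fun=> c)) =
    2^-1 * law (D \o set_coin j c) * law D'.
  have Dc := determined_set_coin c Ds.
  rewrite setIAC determined_split -setIA.
  rewrite (@law_cylinderI _ (undup (s ++ s'))) ?undup_uniq ?law_cylinder //.
  - rewrite expr1 IH ?mulrA //.
    by apply/hasPn => i /ss' /andP[].
  - apply/hasPn => i; rewrite mem_undup mem_cat /= inE => /orP[si|/ss'/andP[]//].
    by apply: contraNneq js => <-.
  - have := determinedI Dc Ds'; apply: determined_sub => i.
    by rewrite mem_undup.
rewrite (law_split j (determinedI Ds Ds')) (law_split j Ds) !half !halfs; lra.
Qed.

(** The first events together are supported by the concatenation of their supports, which avoids the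
    support of the next one; independence then contributes one factor at a time. *)
Lemma law_bigcap_le (E : nat -> set (J -> bool)) (s : nat -> seq J) (a : R) n :
  (forall i, determined_by (s i) (E i)) ->
  (forall i j k, (i < j < n)%N -> k \in s i -> k \notin s j) ->
  (forall i, (i < n)%N -> law (E i) <= a) ->
  law [set w : J -> bool | forall i, (i < n)%N -> E i w] <= a ^+ n.
Proof.
move=> Es; elim: n => [|n IH] sE Ea.
  by rewrite (_ : [set w | _] = setT) ?law_setT //; apply/seteqP; split.
have Cs : determined_by (flatten [seq s i | i <- iota 0 n])
    [set w : J -> bool | forall i, (i < n)%N -> E i w].
  move=> w w' ww'; apply/propext.
  have H i : (i < n)%N -> E i w = E i w'.
    move=> lt_i; apply: Es => j sj; apply: ww'; apply/flatten_mapP.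
    by exists i; rewrite ?mem_iota.
  by split=> Ew i lt_i; [rewrite -H|rewrite H] => //; exact: Ew.
have -> : [set w : J -> bool | forall i, (i < n.+1)%N -> E i w] =
    [set w : J -> bool | forall i, (i < n)%N -> E i w] `&` E n.
  apply/seteqP; split=> [w Ew|w [Ew En] i].
    by split=> [i lt_i|]; apply: Ew => //; exact: ltnW.
  by rewrite ltnS leq_eqVlt => /predU1P[->|/Ew].
rewrite (law_indep Cs (Es n)).
  rewrite exprSr ler_pM ?law_ge0 // ?Ea // IH // => [i j k /andP[ij jn]|i lt_i].
    by apply: sE; rewrite ij ltnW.
  by apply: Ea; rewrite ltnW.
apply/hasPn => k kn; apply/negP => /flatten_mapP[i]; rewrite mem_iota => /= lt_i ki.
by have := sE i n k; rewrite lt_i ltnSn ki kn => /(_ isT isT).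
Qed.

End Law.

(** * Fair coins from binary digits *)

(** For [x] in [0, 1[, the binary digit of weight 2^-(k+1). *)
Definition digit (R : realType) k (x : measurableTypeR R) : bool :=
  odd (Num.truncn (2 ^+ k.+1 * (x : R))).

Lemma measurable_digit (R : realType) k :
  measurable_fun setT (@digit R k).
Proof.
have c0 : (0 : R) < 2 ^+ k.+1 by rewrite exprn_gt0.
apply: (measurable_fun_bool true); rewrite setTI.
rewrite (_ : _ @^-1` _ = \bigcup_(n in setT)
    [set` `[(n.*2.+1)%:R / 2 ^+ k.+1, (n.*2.+2)%:R / 2 ^+ k.+1[]).
  by apply: bigcup_measurable => n _; exact: measurable_itv.
apply/seteqP; split=> x; rewrite /digit /=.
  set t := Num.truncn _ => ot; have et : t = t./2.*2.+1.
    by rewrite -{1}(odd_double_half t) ot.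
  exists t./2 => //=; rewrite in_itv /= ler_pdivrMr // ltr_pdivlMr //.
  (* [Num.truncn] is 0, hence even, on negative numbers, so an odd value forces a nonnegative
     argument. *)
  rewrite ![x * _]mulrC -et; apply: truncn_itv; case: leP => // y0.
  by move: ot; rewrite /t truncn_floor leNgt y0.
move=> [n _]; rewrite /= in_itv /= ler_pdivrMr // ltr_pdivlMr // ![x * _]mulrC.
by move=> /truncn_def ->; rewrite /= odd_double.
Qed.

Lemma truncn_double (R : realType) (y : R) : 0 <= y ->
  (Num.truncn (2 * y))./2 = Num.truncn y.
Proof.
move=> y0; apply/esym/truncn_def.
have /truncn_itv/andP[] : 0 <= 2 * y by rewrite mulr_ge0.
rewrite -{1 2}[Num.truncn (2 * y)]odd_double_half.
set h := _./2; rewrite -addnS -(natr1 h) -addn1 !natrD -!muln2 !natrM.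
by case: odd => /=; lra.
Qed.

(** The integer written [b 0 ... b (N - 1)] in base 2, most significant digit first. *)
Fixpoint digits_value (b : nat -> bool) N : nat :=
  if N is N'.+1 then (b N' + (digits_value b N').*2)%N else 0%N.

Lemma digits_value_lt b N : (digits_value b N < 2 ^ N)%N.
Proof. by elim: N => //= N; rewrite expnS; case: (b N) => /=; lia. Qed.

(** The truncation of [2 ^+ N.+1 * x] has digit [N] as its parity and the truncation of [2 ^+ N * x]
    as its half. *)
Lemma digits_truncn (R : realType) (x : R) b N : 0 <= x < 1 ->
  (forall k, (k < N)%N -> digit k x = b k) <->
  Num.truncn (2 ^+ N * x) = digits_value b N.
Proof.
move=> /andP[x0 x1]; elim: N => [|N IH] /=.
  rewrite expr0 mul1r; split=> // _; apply: truncn_def.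
  by rewrite x0.
have dbl : (Num.truncn (2 ^+ N.+1 * x))./2 = Num.truncn (2 ^+ N * x).
  by rewrite exprS -mulrA truncn_double // mulr_ge0 // exprn_ge0.
split=> [xb|xv].
  rewrite -[LHS]odd_double_half dbl -/(digit N x) xb //; congr (_ + _.*2)%N.
  by apply/IH => k lt_k; rewrite xb // ltnW.
move=> k; rewrite ltnS leq_eqVlt => /predU1P[->|]; last first.
  by apply: (IH.2 _ k); rewrite -dbl xv half_bit_double.
by rewrite /digit xv oddD odd_double addbF oddb.
Qed.

Lemma uniform_prob_itv (R : realType) (u v : R) : 0 <= u -> u < v -> v <= 1 ->
  uniform_prob (@ltr01 R) `[u, v[ = (v - u)%:E.
Proof.
move=> u0 uv v1; rewrite /uniform_prob (eq_integral (fun=> 1%:E)).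
  by rewrite integral_cst //= lebesgue_measure_itv /= lte_fin uv mul1e EFinB.
move=> x; rewrite inE /= in_itv /= => /andP[ux xv].
by rewrite /uniform_pdf (le_trans u0 ux) (le_trans (ltW xv) v1) subr0 invr1.
Qed.

(** Inside [0, 1[ the prescribed digits cut out a dyadic interval of length 2^-N, and the complement
    of [0, 1[ is null. *)
Lemma uniform_digits (R : realType) b N :
  uniform_prob (@ltr01 R) [set x | forall k, (k < N)%N -> digit k x = b k] =
  (2^-1 ^+ N)%:E.
Proof.
set A := [set x | _].
(* [A] is an interval only inside [0, 1[: at 1, for instance, all digits vanish. *)
have mA : measurable A.
  rewrite (_ : A = \bigcap_(k in [set k | (k < N)%N]) (@digit R k @^-1` [set b k])).
    apply: bigcap_measurableType => k _; rewrite -[_ @^-1` _]setTI.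
    exact: measurable_digit.
  by apply/seteqP; split.
have mB : measurable (`[0, 1[ : set (measurableTypeR R)) by exact: measurable_itv.
have PB : uniform_prob (@ltr01 R) (~` `[0, 1[) = 0%E.
  rewrite probability_setC //; transitivity (1%:E - (1 - 0)%:E : \bar R)%E.
    by congr (_ - _)%E; exact: uniform_prob_itv.
  by rewrite subr0 subee.
have c0 : (0 : R) < 2 ^+ N by rewrite exprn_gt0.
have AB : A `&` `[0, 1[ =
    [set` `[(digits_value b N)%:R / 2 ^+ N, (digits_value b N).+1%:R / 2 ^+ N[].
  apply/seteqP; split=> x /=; rewrite !in_itv /= ler_pdivrMr // ltr_pdivlMr //.
    move=> [Ax x01]; rewrite ![x * _]mulrC -((digits_truncn _ _ x01).1 Ax).
    by apply: truncn_itv; rewrite mulr_ge0 ?(ltW c0) //; case/andP: x01.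
  move=> xv; have x01 : 0 <= x < 1.
    case/andP: xv => vx xv; rewrite -(pmulr_lge0 _ c0) (le_trans _ vx) //=.
    rewrite -(ltr_pM2r c0) mul1r (lt_le_trans xv) // -natrX ler_nat.
    exact: digits_value_lt.
  split=> //; apply/(digits_truncn _ _ x01); apply: truncn_def.
  by rewrite mulrC.
rewrite (measureDI _ mA mB) (subset_measure0 _ _ _ PB) ?add0e.
- rewrite AB; apply: etrans (uniform_prob_itv _ _ _) _.
  + by rewrite divr_ge0 // ltW.
  + by rewrite ltr_pM2r ?invr_gt0 // ltr_nat.
  + by rewrite ler_pdivrMr // mul1r -natrX ler_nat digits_value_lt.
  + by rewrite -mulrBl -natrB // subSnn mul1r exprVn.
- exact: measurableD.
- exact: measurableC.
- by move=> x [].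
Qed.

(** Induction on the number of indices below a bound [N] that [s] misses: with none missing, [s]
    lists the prefix; otherwise the law is the sum over both values of a missing coin. *)
Lemma law_prefix_marginal (R : realType) d (Omega : measurableType d)
    (P : probability Omega R) (coin : nat -> {RV P >-> bool}) (s : seq nat) b :
  (forall b N, law coin (cylinder (iota 0 N) b) = 2^-1 ^+ N) ->
  uniq s -> law coin (cylinder s b) = 2^-1 ^+ size s.
Proof.
move=> prefix us; have [N sN] : exists N, forall k, k \in s -> (k < N)%N.
  by exists (\max_(k <- s) k).+1 => k sk; rewrite ltnS; exact: leq_bigmax_seq.
have sub : {subset s <= iota 0 N} by move=> k /sN; rewrite mem_iota.
have : (size s <= N)%N by rewrite -(size_iota 0 N) uniq_leq_size.
move: {2}(N - size s)%N (erefl (N - size s)%N) => n.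
elim: n s b us sub {sN} => [|n IH] s b us sub Nn le_s.
  have szs : size s = N by lia.
  have [|_ si] := uniq_min_size us sub; first by rewrite szs size_iota.
  rewrite szs -(prefix b N); congr (law _ _).
  by apply/seteqP; split=> w wb j sj; apply: wb; rewrite (si, =^~ si).
have [j jN js] : exists2 j, j \in iota 0 N & j \notin s.
  have [/hasP//|/hasPn H] := boolP (has [predC s] (iota 0 N)).
  suff : (N <= size s)%N by lia.
  rewrite -{1}(size_iota 0 N) uniq_leq_size ?iota_uniq // => j /H.
  by rewrite negbK.
have half c : law coin (cylinder (j :: s) (set_coin j c b)) = 2^-1 ^+ (size s).+1.
  rewrite IH //= ?js //; [|lia|lia].
  by move=> k; rewrite inE => /predU1P[->|/sub].
rewrite (law_split coin j (determined_cylinder b)) !cylinder_cons // !half exprS.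
lra.
Qed.

(** A decider makes promises about every probability space carrying fair coins, so refuting it takes
    at least one such space. The digits of a uniform real provide it, indexed through [pickle]. *)
Lemma fair_coins_exist (R : realType) (J : countType) :
  exists (d : measure_display) (Omega : measurableType d)
    (P : probability Omega R) (coin : J -> {RV P >-> bool}), fair_coins coin.
Proof.
pose P : probability _ R := uniform_prob (@ltr01 R).
pose bit k : {RV P >-> bool} := mfun_Sub (mem_set (@measurable_digit R k)).
exists _, _, P, (fun j => bit (pickle j)).
have cyl (s : seq J) b : uniq s ->
    P [set o | {in s, forall j, bit (pickle j) o = b j}] = (2^-1 ^+ size s)%:E.
  move=> us; pose c k := if unpickle k is Some j then b j else false.
  have ums : uniq (map pickle s) by rewrite (map_inj_uniq (pcan_inj pickleK)).
  rewrite (_ : [set o | _] = coin_event bit (cylinder (map pickle s) c)).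
    rewrite (lawE _ (determined_cylinder _)) -(size_map pickle).
    rewrite law_prefix_marginal // => b' N; rewrite /law.
    rewrite (_ : coin_event _ _ = [set x | forall k, (k < N)%N -> digit k x = b' k]).
      by rewrite [P _]uniform_digits.
    apply/seteqP; split=> x H k kN.
      by apply: (H k); rewrite mem_iota.
    by apply: H; rewrite mem_iota in kN.
  apply/seteqP; split=> o H.
    by move=> _ /mapP[j sj ->]; rewrite /c pickleK; exact: H.
  by move=> j sj; have := H _ (map_f pickle sj); rewrite /c pickleK.
have one (j : J) b : P (bit (pickle j) @^-1` [set b]) = (2^-1)%:E.
  rewrite -[in RHS](expr1 2^-1) -(cyl [:: j] (fun=> b)) //; congr (P _).
  apply/seteqP; split=> o H; first by move=> i; rewrite inE => /eqP ->.
  by apply: (H j); rewrite inE.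
split=> // s b us; rewrite [LHS](cyl s b us).
rewrite (eq_bigr (fun=> (2^-1)%:E)) => [|j _]; last exact: one.
by rewrite prodEFin big_const_seq count_predT iter_mulr_1.
Qed.

(** * The lower bound *)

Lemma outputs_at_unique Sigma (A : algorithm Sigma) (T : triplet Sigma) w r r' v
    b b' :
  @outputs_at _ A T w r v b -> outputs_at A w r' v b' -> b = b'.
Proof.
move=> [rb rmin] [rb' rmin']; case: (ltngtP r r') => [/rmin'|/rmin|e].
- by rewrite rb.
- by rewrite rb'.
- by move: rb; rewrite e rb' => -[].
Qed.

(** Under a time bound, an output depends only on the executions of rounds 0 to [K], each of them
    finitely determined. *)
Lemma outputs_determined Sigma (A : algorithm Sigma) (T : triplet Sigma) K b :
  (forall w v r b', @outputs_at _ A T w r v b' -> (r <= K)%N) ->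
  exists s : seq (coin_index T), forall v,
    determined_by s (fun w => outputs A w v b).
Proof.
move=> bound.
have [r|s det_s] := @determined_family (coin_index T) _ 'I_K.+1
    (fun r w => execution A w r).
  have [s det_s] := execution_determined A T r.
  by exists s => w w' ww'; apply/funext => v; exact: det_s.
have imp w w' v : {in s, w =1 w'} -> outputs A w v b -> outputs A w' v b.
  move=> ww' [r out_r]; have le_r := bound _ _ _ _ out_r; case: out_r => rb rmin.
  have E r' : (r' <= r)%N -> execution A w r' v = execution A w' r' v.
    move=> le_r'; have lt_r' : (r' < K.+1)%N by rewrite ltnS (leq_trans le_r').
    by rewrite (det_s (Ordinal lt_r') w w' ww').
  by exists r; split=> [|r' lt_r']; [rewrite -E|rewrite -E ?rmin // ltnW].
exists s => v w w' ww'; apply/propext; split; apply: imp => //.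
by move=> j /ww'.
Qed.

Lemma all_yes_determined Sigma (A : algorithm Sigma) (T : triplet Sigma) K :
  (forall w v r b, @outputs_at _ A T w r v b -> (r <= K)%N) ->
  exists s : seq (coin_index T), determined_by s (@all_yes _ A T).
Proof.
move=> bound; have [s det_s] := outputs_determined true bound.
exists s => w w' ww'; apply/propext; split=> H v.
  by rewrite -(det_s v w w').
by rewrite (det_s v w w').
Qed.

(** The time bound is assumed for [x] alone: the run on [y] copies that on [x] up to its terminating
    round. *)
Lemma outputs_local (A : algorithm bool) m K (x y : 'I_m.+1 -> bool)
    (w w' : 'I_m.+1 * nat * nat -> bool) (v : 'I_m.+1) b :
  (forall w v r b, @outputs_at _ A (path_triplet x) w r v b -> (r <= K)%N) ->
  (forall u, within_dist K u v -> x u = y u) ->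
  (forall u r k, within_dist K u v -> w (u, r, k) = w' (u, r, k)) ->
  @outputs _ A (path_triplet x) w v b -> @outputs _ A (path_triplet y) w' v b.
Proof.
move=> bound xy ww' [r out_r]; have le_r := bound _ _ _ _ out_r.
have E r' : (r' <= r)%N -> @execution _ A (path_triplet x) w r' v =
    @execution _ A (path_triplet y) w' r' v.
  move=> le_r'; apply: execution_local => [u uv|u r'' k uv];
    [apply: xy|apply: ww']; move: uv; rewrite /within_dist; lia.
case: out_r => rb rmin; exists r.
by split=> [|r' lt_r']; [rewrite -E|rewrite -E ?rmin // ltnW].
Qed.

Lemma all_yes_gap (R : realType) (d : measure_display) (Omega : measurableType d)
    (P : probability Omega R) m (coin : 'I_m.+1 * nat * nat -> {RV P >-> bool})
    (A : algorithm bool) K N (a p : R) :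
  fair_coins coin ->
  (forall x w v r b, @outputs_at _ A (@path_triplet m x) w r v b -> (r <= K)%N) ->
  (N * (4 * K + 2) <= m)%N -> 0 <= a -> a ^+ N < p ->
  (forall c, p <= law coin (@all_yes _ A (path_triplet (fun v : 'I_m.+1 => v == c)))) ->
  p + a - 1 <= law coin (@all_yes _ A (path_triplet (fun _ : 'I_m.+1 => false))).
Proof.
move=> fair bound le_m a0 aNp le_p.
pose J : choiceType := ('I_m.+1 * nat * nat)%type.
pose none (v : 'I_m.+1) := false.
pose only (c v : 'I_m.+1) := v == c.
pose yes x : set (J -> bool) := @all_yes _ A (path_triplet x).
(* The spacing exceeds [4 * K], so windows of radius [2 * K] around distinct centers are
   disjoint. *)
pose center i : 'I_m.+1 := inord (i * (4 * K + 2)).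
have centerE i : (i <= N)%N -> center i = (i * (4 * K + 2))%N :> nat.
  move=> le_i; rewrite inordK // ltnS (leq_trans _ le_m) //.
  by rewrite leq_mul2r le_i orbT.
pose arc_yes i : set (J -> bool) := fun w => forall v, within_dist K v (center i) ->
  @outputs _ A (path_triplet none) w v true.
have yes_det x : exists s : seq J, determined_by s (yes x).
  exact: all_yes_determined (bound x).
have [s det_s] : exists s : seq J, forall i, determined_by s (arc_yes i).
  have [s det_s] := outputs_determined true (bound none); exists s => i w w' ww'.
  apply/propext; split=> H v vi.
    by rewrite -(det_s v w w') //; exact: H.
  by rewrite (det_s v w w') //; exact: H.
(* A node of the arc is within [K] of the center and its output depends on coins within [K] of it,
   whence [2 * K]. *)
pose near_center i : pred J := fun j => within_dist (2 * K) j.1.1 (center i).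
have arc_det i : determined_by [seq j <- s | near_center i j] (arc_yes i).
  apply: determined_filter => // w w' ww'.
  have near (v u : 'I_m.+1) r k : within_dist K v (center i) -> within_dist K u v ->
      w (u, r, k) = w' (u, r, k).
    move=> vi uv; apply: ww'; rewrite /near_center unfold_in /=.
    move: vi uv; rewrite /within_dist; lia.
  apply/propext; split=> H v vi; (apply: outputs_local (H v vi) => [|//|u r k uv];
    first exact: bound).
    exact: near uv.
  by apply/esym; exact: near uv.
(* Nodes farther than [K] from [c] cannot tell whether [c] is selected. *)
have yes_far c w v : ~~ within_dist K c v -> yes (only c) w ->
    @outputs _ A (path_triplet none) w v true.
  move=> cv /(_ v); apply: outputs_local => // [|u uv]; first exact: bound.
  by rewrite /only /none; apply/eqP => uc; rewrite -uc uv in cv.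
(* The instance selecting [center 0] makes the other arcs all say yes with
   probability at least [p], although they are independent. *)
have [i lt_i lt_a] : exists2 i, (i < N)%N & a < law coin (arc_yes i.+1).
  apply: contrapT => H.
  suff : p <= a ^+ N by rewrite leNgt aNp.
  have [s0 det0] := yes_det (only (center 0)).
  apply: le_trans (le_p (center 0)) _.
  apply: le_trans (law_bigcap_le fair (fun i => arc_det i.+1) _ _); last 2 first.
  - move=> i j [[u r] k] /andP[ij jN].
    rewrite !mem_filter /near_center /= => /andP[+ _].
    rewrite /within_dist !centerE //; last by lia.
    move=> ui; apply/negP => /andP[uj _].
    have : (i.+1 * (4 * K + 2) + (4 * K + 2) <= j.+1 * (4 * K + 2))%N.
      by rewrite -mulSnr leq_mul2r ltnS ij orbT.
    by lia.
  - by move=> i lt_i; rewrite leNgt; apply/negP => lt_a; apply: H; exists i.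
  apply: (@law_le _ _ _ _ _ _ s0 s) => //.
    move=> w w' ww'; apply/propext; split=> H' i lt_i.
      by rewrite -(det_s i.+1 w w') //; exact: H'.
    by rewrite (det_s i.+1 w w') //; exact: H'.
  move=> w yw i lt_i v vi; apply: yes_far yw; apply/negP.
  move: vi; rewrite /within_dist !centerE //.
  have : (4 * K + 2 <= i.+1 * (4 * K + 2))%N by rewrite leq_pmull.
  by lia.
have [s1 det1] := yes_det (only (center i.+1)).
have [s2 det2] := yes_det none.
have detC : determined_by s (~` arc_yes i.+1).
  by move=> w w' ww'; rewrite /setC /mkset (det_s i.+1 w w').
have lawC : law coin (arc_yes i.+1) + law coin (~` arc_yes i.+1) = 1.
  by rewrite -(law_setU coin (det_s i.+1) detC) ?setICr // setUv law_setT.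
have detU : determined_by (s2 ++ s) (yes none `|` ~` arc_yes i.+1).
  move=> w w' ww'; rewrite /setU /mkset (det2 w w') ?(detC w w') // => j sj;
  by apply: ww'; rewrite mem_cat sj ?orbT.
have := law_le coin det1 detU; rewrite (law_setU coin det2 detC); last first.
  by apply/seteqP; split=> // w [yw]; apply=> v _; exact: yw.
(* With the same coins, nodes outside the arc keep their yes when the center is unselected, and
   nodes of the arc say yes by [arc_yes]. The complement of [arc_yes] costs less than [1 - a]. *)
have sub : yes (only (center i.+1)) `<=` yes none `|` ~` arc_yes i.+1.
  move=> w yw; have [aw|] := pselect (arc_yes i.+1 w); [left => v|by right].
  have [vc|cv] := boolP (within_dist K v (center i.+1)); first exact: aw.
  by apply: yes_far yw; move: cv; rewrite /within_dist andbC.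
move=> /(_ sub); have := le_p (center i.+1).
by rewrite -/(only _) -/(yes _) -/none -/(yes _); lra.
Qed.

Lemma expr_lt_eventually (R : realType) (a e : R) : 0 <= a < 1 -> 0 < e ->
  exists N, a ^+ N < e.
Proof.
move=> /andP[a0 a1] e0.
have /cvgrPdist_lt/(_ e e0)[N _ HN] : a ^+ n @[n --> \oo] --> (0 : R).
  by apply: cvg_expr; rewrite ger0_norm.
exists N; have := HN N (leqnn N).
by rewrite sub0r normrN ger0_norm // exprn_ge0.
Qed.

Theorem theorem3p3 (R : realType) :
  exists (Sigma : countType) (L : language Sigma),
    forall t : triplet Sigma -> R, sublinear t -> ~ B_infty t L.
Proof.
exists bool, selection_language => t sub [p [q [/andP[p0 p1] /andP[q0 q1] pq]]].
(* The midpoint of [2 - p - q] and 1: being below 1 makes the powers of [a] vanish, and being above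
   [2 - p - q] gives [p + a - 1 > 1 - q]. *)
move=> [A [dec run]]; pose a := 1 - (p + q - 1) / 2.
have [N aN] : exists N, a ^+ N < p by apply: expr_lt_eventually => //; rewrite /a; lra.
(* The factor 8 keeps [4 * N * K] within half the order [m.+1]; the summand [4 * N] of [m] leaves
   room for the remaining [2 * N], and [n0] puts the path in the range where [t] is small. *)
pose M := (8 * N.+1)%N; have M0 : (0 : R) < M%:R by rewrite ltr0n.
have [|n0 small] := sub M%:R^-1; first by rewrite invr_gt0.
pose m := (n0 + 4 * N).+1; pose K := (m.+1 %/ M)%N.
have bound x w v r b : @outputs_at _ A (@path_triplet m x) w r v b -> (r <= K)%N.
  move=> /run; have /= := small (path_triplet x).
  have -> : (n0 <= m.+1)%N by rewrite /m; lia.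
  move=> /(_ isT); rewrite normrM normfV [`|m.+1%:R|]ger0_norm //.
  rewrite ler_pdivrMr ?ltr0n // => le_t.
  move=> /le_trans/(_ (ler_norm _))/le_trans/(_ le_t).
  by rewrite mulrC ler_pdivlMr // -natrM ler_nat leq_divRL.
have le_m : (N * (4 * K + 2) <= m)%N.
  have : (K * M <= m.+1)%N by rewrite /K leq_divM.
  by rewrite /M /m; nia.
have [d [W [P [coin fair]]]] := fair_coins_exist R ('I_m.+1 * nat * nat)%type.
pose none (v : 'I_m.+1) := false.
have gap : p + a - 1 <= law coin (@all_yes _ A (path_triplet none)).
  apply: (all_yes_gap fair bound le_m _ aN) => [|c]; first by rewrite /a; lra.
  have [_ /(_ _ _ _ _ fair)[le_law _]] := dec (path_triplet (fun v => v == c)).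
  have [s det_yes] := all_yes_determined (bound (fun v => v == c)).
  move: (le_law (ex_intro _ c (eqxx c))).
  by rewrite (lawE coin det_yes) lee_fin.
have [_ /(_ _ _ _ _ fair)[_ le_law]] := dec (path_triplet none).
have [s det_yes] := all_yes_determined (bound none).
have [s' det_s'] := outputs_determined false (bound none).
have det_no : determined_by s' (@some_no _ A (path_triplet none)).
  move=> w w' ww'; apply/propext; split=> -[v H]; exists v.
    by rewrite -(det_s' v w w').
  by rewrite (det_s' v w w').
have le_q : q <= law coin (@some_no _ A (path_triplet none)).
  by rewrite -lee_fin -(lawE coin det_no); apply: le_law; case.
(* Outputs are unique, so the two events are disjoint and their laws, at least [p + a - 1] and [q],
   would sum to more than 1. *)
have : law coin (@all_yes _ A (path_triplet none) `|`
    @some_no _ A (path_triplet none)) <= 1.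
  rewrite -(law_setT coin).
  apply: (@law_le _ _ _ _ _ _ (s ++ s') [::]) => //.
  move=> w w' ww'; rewrite /setU /mkset (det_yes w w') ?(det_no w w') // => j sj;
  by apply: ww'; rewrite mem_cat sj ?orbT.
rewrite (law_setU coin det_yes det_no); first by move: gap; rewrite /a; lra.
apply/seteqP; split=> // w [yw [v [r no_r]]]; have [r' yes_r] := yw v.
by have := outputs_at_unique yes_r no_r.
Qed.
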